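(* Let $n$ and $d$ be integers with $2\le d\le n$ and let $\mathcal{D}$ be a Ferrers diagram of order $n$. If the pair $(\mathcal{D},d)$ is MDS-constructible, then for every finite field $\mathbb{F}$ there exists a $[\mathcal{D},\nu_{\min}(\mathcal{D},d),d]_{\mathbb{F}}$ MFD code.
   Context: Write $[n]=\{1,\ldots,n\}$. A (top-right justified) Ferrers diagram of order $n$ is a subset $\mathcal{D}\subseteq[n]^2$ such that: if $(i,j)\in\mathcal{D}$ and $j\le j'\le n$, then $(i,j')\in\mathcal{D}$; and if $(i,j)\in\mathcal{D}$ and $1\le i'\le i$, then $(i',j)\in\mathcal{D}$. It is identified with the vector $(c_1,\ldots,c_n)$, $c_j=|\{i\in[n]:(i,j)\in\mathcal{D}\}|$, so $0\le c_1\le\cdots\le c_n\le n$ and $\mathcal{D}=\{(i,j)\in[n]^2: i\le c_j\}$. For a field $\mathbb{F}$, $\mathbb{F}^{\mathcal{D}}$ is the space of matrices $(a_{i,j})\in\mathbb{F}^{n\times n}$ with $a_{i,j}=0$ for all $(i,j)\notin\mathcal{D}$. A $[\mathcal{D},k,d]_{\mathbb{F}}$ (Ferrers diagram rank-metric) code is a $k$-dimensional $\mathbb{F}$-subspace $\mathcal{C}\subseteq\mathbb{F}^{\mathcal{D}}$ whose minimum rank distance $\min\{\operatorname{rk}(A):A\in\mathcal{C},A\ne0\}$ equals $d$. (Convention: for $k=0$ the zero subspace counts as a $[\mathcal{D},0,d]_{\mathbb{F}}$ code.) Define $$\nu_{\min}(\mathcal{D},d)=\min_{0\le j\le d-1}\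 \sum_{i=1}^{n-j}\max\{0,c_i-d+1+j\}.$$ A $[\mathcal{D},k,d]_{\mathbb{F}}$ code with $k=\nu_{\min}(\mathcal{D},d)$ is called a maximum Ferrers diagram (MFD) code. For $i\in[n]$ let $\Delta_i^n=\{(j,j+i-1): j\in[n-i+1]\}$ be the $i$-th diagonal. The pair $(\mathcal{D},d)$ is MDS-constructible if $$\nu_{\min}(\mathcal{D},d)=\sum_{i=1}^n\max\{0,|\mathcal{D}\cap\Delta_i^n|-d+1\}.$$ *)

(* Defs.v *)
From mathcomp Require Import all_boot all_order all_algebra.
Set Implicit Arguments.
Unset Strict Implicit.
Unset Printing Implicit Defensive.

(* Rows and columns are indexed by 'I_n, i.e. 0, ..., n-1 instead of 1, ..., n. *)

(* Top-right justified Ferrers diagrams of order n. *)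
Definition ferrers_diagram (n : nat) (D : {set 'I_n * 'I_n}) : Prop :=
  (forall i j j' : 'I_n, (i, j) \in D -> j <= j' -> (i, j') \in D) /\
  (forall i i' j : 'I_n, (i, j) \in D -> i' <= i -> (i', j) \in D).

Definition col_height (n : nat) (D : {set 'I_n * 'I_n}) (j : 'I_n) : nat :=
  #|[set i : 'I_n | (i, j) \in D]|.

(* Subtraction on nat is truncated, so c + j + 1 - d is max(0, c - d + 1 + j). *)
Definition nu (n : nat) (D : {set 'I_n * 'I_n}) (d j : nat) : nat :=
  \sum_(i < n | i < n - j) (col_height D i + j + 1 - d).

(* The default value nu D d 0 is itself one of the terms when 0 < d. *)
Definition nu_min (n : nat) (D : {set 'I_n * 'I_n}) (d : nat) : nat :=
  \big[minn/nu D d 0]_(j < d) nu D d j.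

(* The diagonal at distance r from the main one, i.e. Delta_(r + 1)^n. *)
Definition diagonal (n r : nat) : {set 'I_n * 'I_n} :=
  [set p : 'I_n * 'I_n | p.2 == p.1 + r :> nat].

Definition MDS_constructible (n : nat) (D : {set 'I_n * 'I_n}) (d : nat) : Prop :=
  nu_min D d = \sum_(r < n) (#|D :&: diagonal n r| + 1 - d).

Definition supported_on (F : fieldType) (n : nat) (D : {set 'I_n * 'I_n})
    (A : 'M[F]_n) : Prop :=
  forall i j : 'I_n, (i, j) \notin D -> A i j = 0%R.

Definition has_min_rank_distance (F : fieldType) (n : nat)
    (C : {vspace 'M[F]_n}) (d : nat) : Prop :=
  (exists A : 'M[F]_n, [/\ A \in C, A != 0%R & \rank A = d]) /\
  (forall A : 'M[F]_n, A \in C -> A != 0%R -> d <= \rank A).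

(* C is a [D, k, d]_F code; the zero space, which has no minimum distance,
   counts as a [D, 0, d]_F code for every d. *)
Definition ferrers_code (F : fieldType) (n : nat) (D : {set 'I_n * 'I_n})
    (k d : nat) (C : {vspace 'M[F]_n}) : Prop :=
  [/\ forall A : 'M[F]_n, A \in C -> supported_on D A,
      \dim C = k
    & k = 0 \/ has_min_rank_distance C d].

Definition MFD_code (F : fieldType) (n : nat) (D : {set 'I_n * 'I_n})
    (d : nat) (C : {vspace 'M[F]_n}) : Prop :=
  ferrers_code D (nu_min D d) d C.

(* Main.v *)
Require Import Defs.
From HB Require Import structures.
From mathcomp Require Import all_boot all_order all_algebra all_field.
From mathcomp Require Import mxabelem.
From mathcomp Require Import zify.
(** Let theta = sigma - 1, where sigma is the q-Frobenius of a finite extension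
    L of F = GF(q).  Choose L so that some x in L has theta^n x = 0 but
    theta^(n-1) x <> 0.  Then v_j = theta^(n-1-j) x (j < n) is an F-basis of
    ker theta^n, with ker theta^j = <v_0, ..., v_(j-1)>.  The product rule
    theta(xy) = theta(x) y + sigma(x) theta(y) shows that
    ker theta^(a+1) . ker theta^(b+1) lies in ker theta^(a+b+1), so the operators
    sum_(s <= t <= n-d) a_t theta^t with a_t in ker theta^(t-s+1) have, in the
    basis v, matrices supported on the diagonals of distance at least s.  Each of
    them, if nonzero, is a linearized polynomial of degree at most q^(n-d), so its
    kernel has dimension at most n-d and its rank is at least d.

    If (D, d) is MDS-constructible, let s be the least distance of a diagonal that
    meets D in at least d cells.  Comparing nu_min with the diagonal sums shows
    that D contains the first d-1-j and the last j cells of the diagonal s, where j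
    attains the minimum, hence of all later diagonals.  So the cells missing from D
    on a diagonal r >= s number at most max(0, n-r-d+1), and imposing that they
    vanish leaves a space of dimension at least nu_min.  Finally nu_min exceeds the
    number of cells of D outside the first d-j rows and the last j columns, so some
    nonzero codeword is supported on these d lines and has rank at most d. *)

Set Implicit Arguments.
Unset Strict Implicit.
Unset Printing Implicit Defensive.
Import GRing.Theory FinRing.Theory.

(** * Matrices supported on a set of cells *)

Definition upper_triangle (n s : nat) : {set 'I_n * 'I_n} :=
  [set p : 'I_n * 'I_n | p.1 + s <= p.2].

Section SupportedSpace.
Variables (F : fieldType) (n : nat).
Implicit Types (S T : {set 'I_n * 'I_n}) (A : 'M[F]_n).
Local Open Scope ring_scope.

Definition supp_space S : {vspace 'M[F]_n} :=
  <<[seq delta_mx p.1 p.2 | p <- enum S]>>%VS.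

Lemma supp_spaceP S A : reflect (supported_on S A) (A \in supp_space S).
Proof.
apply: (iffP idP) => [/coord_span -> i j Sij | suppA].
  rewrite summxE big1 // => k _; rewrite mxE.
  have ltk : (k < size [seq delta_mx p.1 p.2 : 'M[F]_n | p <- enum S])%N.
    by rewrite size_map -cardE.
  have /mapP[p pS ->] := mem_nth 0 ltk; rewrite mxE.
  case: andP => [[/eqP Ei /eqP Ej]|_]; last by rewrite mulr0.
  by move: Sij; rewrite Ei Ej -surjective_pairing -mem_enum pS.
rewrite (matrix_sum_delta A); apply: memv_suml => i _; apply: memv_suml => j _.
have [Sij | /suppA ->] := boolP ((i, j) \in S); last by rewrite scale0r mem0v.
apply/memvZ/memv_span/mapP; exists (i, j) => //; by rewrite mem_enum.
Qed.

(** A spanning family only bounds the dimension from above, but the spaces of [S] and of its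
    complement together span all matrices, so both bounds are equalities. *)
Lemma dim_supp_space S : \dim (supp_space S) = #|S|.
Proof.
have le T : (\dim (supp_space T) <= #|T|)%N.
  by apply: leq_trans (dim_span _) _; rewrite size_map -cardE.
have full : (\dim {:'M[F]_n} <= \dim (supp_space S) + \dim (supp_space (~: S)))%N.
  apply: leq_trans (dimv_add_leqif _ _); apply: dimvS; apply/subvP => A _.
  pose B T := \matrix_(i, j) (if (i, j) \in T then A i j else 0).
  have -> : A = B S + B (~: S).
    by apply/matrixP => i j; rewrite !mxE inE; case: ifP; rewrite (addr0, add0r).
  apply: memv_add; apply/supp_spaceP => i j; rewrite mxE;
    by case: ((_, _) \in _).
apply/eqP; rewrite eqn_leq le -(leq_add2r #|~: S|) cardsC card_prod card_ord.
by move: full; rewrite dimvf => /leq_trans; apply; rewrite leq_add2l.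
Qed.

(** Each cell of [S :\: T] imposes one linear equation, so it costs at most one dimension. *)
Lemma dim_cap_supp_space (V : {vspace 'M[F]_n}) S T :
  (V <= supp_space S)%VS ->
  (\dim V <= \dim (V :&: supp_space T) + #|S :\: T|)%N.
Proof.
move=> sVS; have := dimv_sum_cap V (supp_space (S :&: T)).
have : (V :&: supp_space (S :&: T) <= V :&: supp_space T)%VS.
  apply: (capvS (subvv V)); apply/subvP => A /supp_spaceP suppA.
  by apply/supp_spaceP => i j Tij; apply: suppA; rewrite inE (negPf Tij) andbF.
move/dimvS; rewrite dim_supp_space.
have : (V + supp_space (S :&: T) <= supp_space S)%VS.
  rewrite subv_add sVS; apply/subvP => A /supp_spaceP suppA.
  by apply/supp_spaceP => i j Sij; apply: suppA; rewrite inE (negPf Sij).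
move/dimvS; rewrite dim_supp_space; move: (cardsID T S); lia.
Qed.

Lemma rank_rows_cols (a b : nat) A :
  (a <= n)%N -> (b <= n)%N ->
  (forall i j : 'I_n, (a <= i)%N -> (j < n - b)%N -> A i j = 0) ->
  (\rank A <= a + b)%N.
Proof.
move=> le_an le_bn A0.
(* The first [a] rows, plus the other rows, which are nonzero only in the last [b] columns. *)
have -> : A = pid_mx a *m A + copid_mx a *m A *m copid_mx (n - b).
  rewrite /copid_mx mulmxBr mulmx1 mulmxBl mul1mx.
  suff -> : (A - pid_mx a *m A) *m (pid_mx (n - b) : 'M_n) = 0.
    by rewrite subr0 addrC subrK.
  apply/matrixP => i j; rewrite !mxE big1 // => k _.
  rewrite !mxE (bigD1 i) //= mxE eqxx big1 ?addr0 => [|l /negPf nli]; last first.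
    by rewrite mxE eq_sym val_eqE nli mul0r.
  case: (ltnP i a) => le_ai /=; first by rewrite mul1r subrr mul0r.
  case: eqP => //= _; last by rewrite mulr0.
  by case: ltnP => lt_j; rewrite ?mulr0 // A0 // mulr0 subr0 mul0r.
apply: leq_trans (mxrank_add _ _) (leq_add _ _).
  by apply: leq_trans (mxrankM_maxl _ _) _; rewrite rank_pid_mx.
apply: leq_trans (mxrankM_maxr _ _) _; rewrite rank_copid_mx ?leq_subr //; lia.
Qed.

Lemma exists_subspace (vT : vectType F) (V : {vspace vT}) k :
  (k <= \dim V)%N -> exists2 U : {vspace vT}, (U <= V)%VS & \dim U = k.
Proof.
move=> le_k; exists <<take k (vbasis V)>>%VS.
  by apply/span_subvP => v /mem_take /vbasis_mem.
have : free (take k (vbasis V) ++ drop k (vbasis V)).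
  by rewrite cat_take_drop (basis_free (vbasisP V)).
by move/catl_free/eqnP->; rewrite size_takel // size_tuple.
Qed.

End SupportedSpace.

(** * The operator x |-> x^q - x and its matrices *)

Section FrobeniusMinusOne.
Variables (F : finFieldType) (L : fieldExtType F).
Implicit Types (x y : L) (r : nat).
Local Open Scope ring_scope.

Definition theta x : L := x ^+ #|F| - x.

(** The ring is a parameter because the polynomial serves over [F] to build an extension and over
    [L] to count roots. *)
Definition theta_poly (R : nzRingType) r : {poly R} :=
  iter r (fun p => p ^+ #|F| - p) 'X.

Lemma horner_theta_poly r x : (theta_poly L r).[x] = iter r theta x.
Proof. by elim: r => [|r IHr]; rewrite ?hornerX //= !hornerE IHr. Qed.

Lemma map_theta_poly r : map_poly (in_alg L) (theta_poly F r) = theta_poly L r.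
Proof.
by elim: r => [|r IHr]; rewrite ?map_polyX //= rmorphB rmorphXn /= IHr.
Qed.

Lemma size_theta_poly (R : idomainType) r :
  size (theta_poly R r) = (#|F| ^ r).+1.
Proof.
have gt1 := finNzRing_gt1 F.
elim: r => [|r IHr]; first by rewrite size_polyX.
have sz : size (theta_poly R r ^+ #|F|) = (#|F| ^ r.+1).+1.
  have := size_exp (theta_poly R r) #|F|; rewrite IHr expnSr /= => <-.
  rewrite prednK // lt0n.
  by rewrite size_poly_eq0 expf_neq0 // -size_poly_eq0 IHr.
by rewrite /= size_polyDl sz // size_polyN IHr ltnS ltn_exp2l.
Qed.

(** The order q of [F] is a power of the characteristic, so x^q is additive, and a^q = a for a in
    [F]. *)
Lemma theta_is_linear : linear theta.
Proof.
move=> a x y; rewrite /theta; have [p p_pr pF] := finPcharP F.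
have pnat : [pchar L].-nat #|F|.
  have := pprimeChar_pgroup pF; rewrite /pgroup.pgroup cardsT.
  by apply: sub_in_pnat => r _ /eqP ->; rewrite pchar_lalg.
rewrite exprDn_pchar // exprZn expf_card scalerBr opprD !addrA.
by congr (_ - _); rewrite addrAC.
Qed.

HB.instance Definition _ :=
  GRing.isLinear.Build F L L _ theta theta_is_linear.

Lemma iter_theta_is_linear r : linear (iter r theta).
Proof. by move=> a x y; elim: r => //= r ->; rewrite linearP. Qed.

HB.instance Definition _ r :=
  GRing.isLinear.Build F L L _ (iter r theta) (iter_theta_is_linear r).

Lemma theta_eq0 x : theta x = 0 -> exists a : F, x = a%:A.
Proof.
move/eqP; rewrite subr_eq0 => xq.
have : x \in (1%AS : {vspace L}).
  by rewrite Fermat's_little_theorem dimv1 expn1.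
by case/vlineP => a ->; exists a.
Qed.

Lemma thetaM x y : theta (x * y) = theta x * y + (theta x + x) * theta y.
Proof.
by rewrite /theta subrK exprMn mulrBl mulrBr [RHS]addrC addrA subrK.
Qed.

(** Induction on a + b: each summand of the product rule has one of the two indices lowered by one,
    and vanishes if that index was 0. *)
Lemma iter_thetaM a b x y :
  iter a.+1 theta x = 0 -> iter b.+1 theta y = 0 ->
  iter (a + b).+1 theta (x * y) = 0.
Proof.
elim: {a b}(a + b)%N {-2}a {-2}b (erefl (a + b)%N) x y => [|N IHN] a b abN x y.
  have [-> ->] : a = 0%N /\ b = 0%N by lia.
  by move=> /= tx ty; rewrite thetaM tx ty mul0r mulr0 addr0.
move=> Kx Ky; rewrite abN iterSr thetaM linearD.
rewrite -[RHS]addr0; congr (_ + _).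
  case: a abN Kx => [|a] abN Kx; first by move: Kx => /= ->; rewrite mul0r !linear0.
  have Nab : (a + b)%N = N by lia.
  by change (iter N.+1 theta (theta x * y) = 0); rewrite -Nab IHN // -iterSr.
case: b abN Ky => [|b] abN Ky; first by move: Ky => /= ->; rewrite mulr0 !linear0.
have Nab : (a + b)%N = N by lia.
change (iter N.+1 theta ((theta x + x) * theta y) = 0).
rewrite -Nab IHN // -?iterSr // linearD.
by rewrite -[RHS]addr0; congr (_ + _); rewrite ?Kx // -[LHS]iterSr iterS Kx linear0.
Qed.

End FrobeniusMinusOne.

(** * The chain as a basis, and the matrices of operators in [theta] on it *)

Section Chain.
Variables (F : finFieldType) (L : fieldExtType F) (n : nat) (x0 : L).
Local Open Scope ring_scope.
Hypothesis n_gt0 : (0 < n)%N.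
Hypothesis theta_x0 : iter n (@theta F L) x0 = 0.
Hypothesis theta_x0_neq0 : iter n.-1 (@theta F L) x0 != 0.
Local Notation theta := (@theta F L).

Definition chain j : L := iter (n.-1 - j) theta x0.

Lemma iter_theta0 r : iter r theta 0 = 0.
Proof. by elim: r => //= r ->; rewrite linear0. Qed.

Lemma iter_theta_leq a b x :
  (a <= b)%N -> iter a theta x = 0 -> iter b theta x = 0.
Proof. by move=> /subnK <- ax; rewrite iterD ax iter_theta0. Qed.

Lemma iter_theta_chain r j :
  (r <= j < n)%N -> iter r theta (chain j) = chain (j - r).
Proof. by move=> rj; rewrite -iterD; congr iter; lia. Qed.

Lemma iter_theta_chain0 r j :
  (j < n)%N -> (j < r)%N -> iter r theta (chain j) = 0.
Proof. by move=> jn jr; rewrite -iterD; apply: iter_theta_leq theta_x0; lia. Qed.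

(** Induction on [j]: expand [theta y] in the chain and raise every index by one. The difference
    with [y] is killed by [theta], so it lies in [F], the line spanned by [chain 0]. *)
Lemma iter_theta_eq0 j y : (j <= n)%N -> iter j theta y = 0 ->
  exists c : nat -> F, y = \sum_(u < j) c u *: chain u.
Proof.
elim: j y => [|j IHj] y jn; first by move=> /= ->; exists (fun=> 0); rewrite big_ord0.
rewrite iterSr => /(IHj _ (ltnW jn)) [c yc].
have [a ya] : exists a : F, y - \sum_(u < j) c u *: chain u.+1 = a%:A.
  apply: theta_eq0; rewrite linearB linear_sum /= yc -sumrB big1 // => u _.
  rewrite linearZ /= -[theta (chain _)]/(iter 1 theta (chain u.+1)).
  have lt_uj := ltn_ord u; rewrite iter_theta_chain ?subn1 ?subrr //; lia.
have [b vb] : exists b : F, chain 0 = b%:A.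
  apply: theta_eq0; exact: (@iter_theta_chain0 1).
have b0 : b != 0.
  by apply: contraNneq theta_x0_neq0 => b0; move: vb; rewrite b0 scale0r /chain subn0 => ->.
exists (fun u => if u is u'.+1 then c u' else a / b).
by rewrite big_ord_recl /= vb scalerA divfK // -ya subrK.
Qed.

(** Applying [theta] m times to a sum of m + 1 terms kills all but the last, which becomes a
    multiple of the nonzero [chain 0]. *)
Lemma sum_chain_eq0 m (c : nat -> F) : (m <= n)%N ->
  \sum_(u < m) c u *: chain u = 0 -> forall u, (u < m)%N -> c u = 0.
Proof.
elim: m => // m IHm lt_mn sum0.
have cm : c m = 0.
  have := congr1 (iter m theta) sum0; rewrite iter_theta0 linear_sum /=.
  rewrite big_ord_recr /= big1 ?add0r => [|u _]; rewrite linearZ /=; last first.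
    by rewrite iter_theta_chain0 ?scaler0 //; have := ltn_ord u; lia.
  rewrite iter_theta_chain ?leqnn // subnn => /eqP; rewrite scaler_eq0.
  by rewrite /chain subn0 (negPf theta_x0_neq0) orbF => /eqP.
move: sum0; rewrite big_ord_recr /= cm scale0r addr0 => /(IHm (ltnW lt_mn)) IH u.
by rewrite ltnS leq_eqVlt => /predU1P[-> // | /IH].
Qed.

Let chain_tuple := [tuple chain i | i < n].

Let nth_chain (i : 'I_n) : chain_tuple`_i = chain i.
Proof. by rewrite -tnth_nth tnth_mktuple. Qed.

Let free_chain : free chain_tuple.
Proof.
apply/freeP => k k0 i; pose c u := oapp k 0 (insub u : option 'I_n).
have ck (j : 'I_n) : c j = k j by rewrite /c valK.
rewrite -ck; apply: (@sum_chain_eq0 n) => //.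
by rewrite -[RHS]k0; apply: eq_bigr => j _; rewrite ck nth_chain.
Qed.

Let coord_chain m (c : nat -> F) (i : 'I_n) : (m <= n)%N ->
  coord chain_tuple i (\sum_(u < m) c u *: chain u) = if (i < m)%N then c i else 0.
Proof.
move=> le_mn; rewrite (big_ord_widen n (fun u => c u *: chain u)) // big_mkcond /=.
rewrite -[RHS](coord_sum_free (fun i : 'I_n => if (i < m)%N then c i else 0) _ free_chain).
congr coord; apply: eq_bigr => j _; rewrite nth_chain.
by case: ifP; rewrite ?scale0r.
Qed.

Definition theta_op (X : 'M[F]_n) y : L :=
  \sum_(t < n) (\sum_(u < n) X t u *: chain u) * iter t theta y.

(** Since [coord] is linear on all of [L], this is linear in every [X]; it represents [theta_op X]
    on the span of the chain once that span is stable. *)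
Definition theta_mx (X : 'M[F]_n) : 'M[F]_n :=
  \matrix_(i, j) coord chain_tuple i (theta_op X (chain j)).

Lemma theta_mx_is_linear : linear theta_mx.
Proof.
move=> a X Y; apply/matrixP => i j; rewrite !mxE -linearP; congr coord.
rewrite /theta_op scaler_sumr -big_split /=; apply: eq_bigr => t _.
rewrite scalerAl -mulrDl scaler_sumr -big_split /=; congr (_ * _).
by apply: eq_bigr => u _; rewrite !mxE scalerDl scalerA.
Qed.

HB.instance Definition _ :=
  GRing.isLinear.Build F 'M[F]_n 'M[F]_n _ theta_mx theta_mx_is_linear.

Lemma theta_op_is_linear X : linear (theta_op X).
Proof.
move=> a y z; rewrite /theta_op scaler_sumr -big_split /=; apply: eq_bigr => t _.
by rewrite linearP mulrDr scalerAr.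
Qed.

HB.instance Definition _ X :=
  GRing.isLinear.Build F L L _ (theta_op X) (theta_op_is_linear X).

Lemma theta_op_poly X y :
  theta_op X y =
  (\sum_(t < n) (\sum_(u < n) X t u *: chain u) *: theta_poly F L t).[y].
Proof.
by rewrite horner_sum; apply: eq_bigr => t _; rewrite hornerZ horner_theta_poly.
Qed.

(** The degrees q^t are distinct, so the top nonzero term cannot cancel. *)
Lemma sum_theta_poly_neq0 m (a : nat -> L) (t : nat) : (t < m)%N -> a t != 0 ->
  \sum_(t < m) a t *: theta_poly F L t != 0.
Proof.
elim: m => // m IHm; rewrite ltnS leq_eqVlt big_ord_recr /=.
have [am0 | am_neq0 _ _] := eqVneq (a m) 0.
  by case/predU1P=> [-> | lt_tm at0]; rewrite am0 ?eqxx // scale0r addr0 IHm.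
rewrite addrC -size_poly_gt0 size_polyDl size_scale // size_theta_poly //.
rewrite ltnS; apply: leq_trans (size_sum _ _ _) _; apply/bigmax_leqP => u _.
apply: leq_trans (size_scale_leq _ _) _; rewrite size_theta_poly.
by rewrite ltn_exp2l ?finNzRing_gt1.
Qed.

Variables s d : nat.
Hypothesis ds_leqn : (d + s <= n)%N.

(* The cell (t, u) stands for the operator y |-> v_u * theta^t y. *)
Definition theta_supp : {set 'I_n * 'I_n} :=
  [set p : 'I_n * 'I_n | (p.2 + s <= p.1)%N && (p.1 + d <= n)%N].

Lemma theta_op_chain X (j : 'I_n) : supported_on theta_supp X ->
  exists2 c : nat -> F, theta_op X (chain j) = \sum_(u < n) c u *: chain u
                      & forall u, (j < u + s)%N -> c u = 0.
Proof.
move=> suppX; have lt_jn := ltn_ord j.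
(* For j < s the exponent truncates to 0, and the image itself is 0. *)
suff K : iter (j.+1 - s)%N theta (theta_op X (chain j)) = 0.
  have [|c ->] := iter_theta_eq0 _ K; first lia.
  exists (fun u => if (u < j.+1 - s)%N then c u else 0) => [|u]; last first.
    by case: ifP => //; lia.
  rewrite (big_ord_widen n (fun u => c u *: chain u)) ?big_mkcond /=; last lia.
  by apply: eq_bigr => u _; case: ifP => //; rewrite scale0r.
rewrite /theta_op linear_sum big1 // => t _.
rewrite mulr_suml linear_sum big1 // => u _.
have [/[!inE]/andP[le_ut _] | /suppX ->] := boolP ((t, u) \in theta_supp); last first.
  by rewrite scale0r mul0r linear0.
rewrite -scalerAl linearZ /=; move: le_ut => /= le_ut.
have [lt_jt | le_tj] := ltnP j t.
  by rewrite (iter_theta_chain0 lt_jn lt_jt) mulr0 iter_theta0 scaler0.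
rewrite iter_theta_chain ?le_tj //.
(* The bound on the exponent comes from u + s <= t, the support condition on the cell (t, u). *)
rewrite (@iter_theta_leq (u + (j - t)).+1) ?scaler0 //; first lia.
by apply: iter_thetaM; apply: iter_theta_chain0 => //; lia.
Qed.

Lemma theta_mx_supp X : supported_on theta_supp X ->
  supported_on (upper_triangle n s) (theta_mx X).
Proof.
move=> suppX i j; rewrite inE -ltnNge /= mxE => lt_ji.
have [c -> c0] := theta_op_chain j suppX.
by rewrite coord_chain // ltn_ord c0.
Qed.

Lemma theta_op_theta_mx X (j : 'I_n) : supported_on theta_supp X ->
  theta_op X (chain j) = \sum_i theta_mx X i j *: chain i.
Proof.
move=> suppX; have [c opX _] := theta_op_chain j suppX; rewrite opX.
by apply: eq_bigr => i _; rewrite mxE opX coord_chain // ltn_ord.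
Qed.

Lemma rank_theta_mx X : supported_on theta_supp X -> X != 0 ->
  (d <= \rank (theta_mx X))%N.
Proof.
move=> suppX X_neq0; set A := theta_mx X.
pose a t := \sum_(u < n) oapp (fun t => X t u) 0 (insub t : option 'I_n) *: chain u.
pose p := \sum_(t < n) a t *: theta_poly F L t.
have aE (t : 'I_n) : a t = \sum_(u < n) X t u *: chain u.
  by apply: eq_bigr => u _; rewrite valK.
have p_neq0 : p != 0.
  have [t at0] : exists t : 'I_n, a t != 0.
    apply/existsP; apply: contraR X_neq0 => /existsPn a0.
    apply/eqP/matrixP => t u; rewrite mxE.
    pose c u := oapp (X t) 0 (insub u); have cE w : c (val w) = X t w by rewrite /c valK.
    rewrite -cE; apply: (@sum_chain_eq0 n _ (leqnn n)) (ltn_ord u).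
    rewrite -[RHS](eqP (negPn (a0 t))) aE.
    by apply: eq_bigr => w _; rewrite cE.
  exact: sum_theta_poly_neq0 (ltn_ord t) at0.
have p_op y : p.[y] = theta_op X y.
  by rewrite theta_op_poly; congr _.[y]; apply: eq_bigr => t _; rewrite aE.
pose f (y : 'rV[F]_n) := \sum_j y 0 j *: chain j.
have f_inj : injective f.
  move=> y z fyz; apply/rowP => j.
  pose c u := oapp (fun j => y 0 j - z 0 j) 0 (insub u : option 'I_n).
  have := @sum_chain_eq0 n c (leqnn n) _ j (ltn_ord j); rewrite /c valK /=.
  move=> H; apply/eqP; rewrite -subr_eq0 H //.
  rewrite -[RHS](subrr (f z)) -{1}fyz -sumrB; apply: eq_bigr => w _.
  by rewrite valK scalerBl.
(* [kermx] is a left kernel, hence the transpose. Its q^(n - rank A) vectors give distinct roots of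
   [p]. *)
have Uf : uniq [seq f y | y <- enum (rowg (kermx A^T))].
  by rewrite map_inj_uniq ?enum_uniq.
have rootf : all (root p) [seq f y | y <- enum (rowg (kermx A^T))].
  apply/allP => _ /mapP[y /[!mem_enum]/[!mem_rowg]/sub_kermxP yA ->].
  rewrite rootE p_op linear_sum; apply/eqP.
  under eq_bigr => j _ do rewrite linearZ /= theta_op_theta_mx // scaler_sumr.
  rewrite exchange_big big1 //= => i _.
  under eq_bigr => j _ do rewrite scalerA.
  rewrite -scaler_suml; move/rowP/(_ i): yA; rewrite !mxE.
  under eq_bigr => j _ do rewrite mxE.
  by move->; rewrite scale0r.
have := max_poly_roots p_neq0 rootf Uf.
rewrite size_map -cardE card_rowg mxrank_ker mxrank_tr => lt_p.
have : (#|F| ^ (n - \rank A) < (#|F| ^ (n - d)).+1)%N.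
  apply: leq_trans lt_p _; apply: leq_trans (size_sum _ _ _) _.
  (* Coefficients with t > n - d vanish by the support condition, which caps the degree at q^(n -
     d). *)
  apply/bigmax_leqP => t _; have [le_tn | gt_tn] := leqP (t + d) n.
    apply: leq_trans (size_scale_leq _ _) _; rewrite size_theta_poly ltnS.
    by rewrite leq_exp2l ?finNzRing_gt1 //; lia.
  rewrite aE big1 ?scale0r ?size_poly0 // => u _.
  by rewrite suppX ?scale0r // inE negb_and -!ltnNge gt_tn orbT.
rewrite ltnS leq_exp2l ?finNzRing_gt1 //; have := rank_leq_row A; lia.
Qed.

End Chain.

(** * A finite extension containing a chain of given length *)

Section ChainExistence.
Variables (F : finFieldType) (n : nat).
Local Open Scope ring_scope.

Lemma exists_theta_chain :
  exists (L : fieldExtType F) (x : L),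
    iter n.+1 (@theta F L) x = 0 /\ iter n (@theta F L) x != 0.
Proof.
have q_gt1 := finNzRing_gt1 F; have sz := size_theta_poly F F n.
(* At a root x of p, y = theta^n x satisfies y^(q-1) = 1, i.e. y <> 0 and
   theta y = 0. *)
pose p := theta_poly F F n ^+ #|F|.-1 - 1.
have sz_p : (1 < size p)%N.
  have sz_pow : (1 < size (theta_poly F F n ^+ #|F|.-1))%N.
    rewrite -subn_gt0 subn1 size_exp sz muln_gt0 expn_gt0 (ltnW q_gt1) /=.
    by rewrite -subn1 subn_gt0.
  by rewrite /p size_polyDl // size_polyN size_poly1.
have p_neq0 : p != 0 by rewrite -size_poly_gt0 ltnW.
have [L [zs Dp _]] := FinSplittingFieldFor p_neq0.
exists L; have [x] : exists x, root (map_poly (in_alg L) p) x.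
  (* An empty list of roots would make [p] constant, against [sz_p]. *)
  case: zs Dp => [|z zs] Dp; last first.
    by exists z; rewrite (eqp_root Dp) root_prod_XsubC mem_head.
  by move: sz_p; rewrite -(size_map_poly (in_alg L)) (eqp_size Dp) big_nil size_poly1.
rewrite /p rmorphB rmorphXn rmorph1 /= map_theta_poly rootE !hornerE.
rewrite horner_theta_poly subr_eq0 => /eqP xq1; exists x.
have nz : iter n (theta (L := L)) x != 0.
  apply: contra_eq_neq xq1 => ->; rewrite expr0n eq_sym.
  by rewrite -subn1 subn_eq0 leqNgt q_gt1 oner_neq0.
split=> //=; move: (iter n _ x) xq1 => y yq1.
by rewrite /theta -[in X in X - _](prednK (ltnW q_gt1)) exprS yq1 mulr1 subrr.
Qed.

End ChainExistence.

(** The code is the image of [theta_mx], which is injective on this support: a nonzero [X] has image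
    of rank at least d > 0. *)
Lemma triangular_code (F : finFieldType) (n d s : nat) :
  0 < d -> d + s <= n ->
  exists W : {vspace 'M[F]_n},
    [/\ (W <= supp_space F (upper_triangle n s))%VS,
        forall A, A \in W -> A != 0%R -> d <= \rank A
      & \dim W = #|theta_supp n s d|].
Proof.
move=> d_gt0 le_dsn; case: n le_dsn => [|n] le_dsn; first lia.
have [L [x [x0 x1]]] := exists_theta_chain F n.
pose f := linfun (@theta_mx F L n.+1 x).
have rk := @rank_theta_mx F L n.+1 x (ltn0Sn n) x0 x1 s d le_dsn.
exists (f @: supp_space F (theta_supp n.+1 s d))%VS; split.
- apply/subvP => _ /memv_imgP[X /supp_spaceP suppX ->]; rewrite lfunE.
  apply/supp_spaceP; exact: (theta_mx_supp _ x0 x1 le_dsn).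
- move=> _ /memv_imgP[X /supp_spaceP suppX ->]; rewrite lfunE /= => fX.
  by apply: rk => //; apply: contraNneq fX => ->; rewrite linear0.
- rewrite limg_dim_eq ?dim_supp_space //; apply/eqP; rewrite -subv0.
  apply/subvP => X /memv_capP[/supp_spaceP suppX].
  rewrite memv_ker lfunE memv0 /= => /eqP fX0; apply: contraTT d_gt0 => X_neq0.
  by rewrite -leqNgt; have := rk X suppX X_neq0; rewrite fX0 mxrank0.
Qed.

(** * Counting cells on diagonals *)

Lemma card_sum_mem (T : finType) (A : {set T}) : #|A| = \sum_x (x \in A : nat).
Proof. by rewrite -sum1_card big_mkcond; apply: eq_bigr => x _; case: (x \in A). Qed.

Section Counting.
Variable n : nat.
Implicit Types (D S : {set 'I_n * 'I_n}) (r h j : nat).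

Lemma card_ord_interval a b : b <= n -> #|[set i : 'I_n | a <= i < b]| = b - a.
Proof.
move=> le_bn; rewrite cardE -(size_map val) -[RHS](size_iota a).
apply/perm_size/uniq_perm; rewrite ?map_inj_uniq ?enum_uniq ?iota_uniq //.
  exact: val_inj.
move=> k; rewrite mem_iota; apply/mapP/idP => [[i /[!mem_enum]/[!inE] ? ->]|ltk] /=.
  by lia.
have ltkn : k < n by lia.
by exists (Ordinal ltkn); rewrite // mem_enum inE /=; lia.
Qed.

Lemma leq_card_ord_interval a b : #|[set i : 'I_n | a <= i < b]| <= b - a.
Proof.
have -> : [set i : 'I_n | a <= i < b] = [set i : 'I_n | a <= i < minn b n].
  by apply/setP => i; rewrite !inE leq_min ltn_ord andbT.
rewrite card_ord_interval ?geq_minr //; lia.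
Qed.

(** A cell of a given diagonal is determined by its row. *)
Lemma leq_card_diagonal_rows r a b S :
  S \subset diagonal n r -> (forall p, p \in S -> a <= p.1 < b) -> #|S| <= b - a.
Proof.
move=> /subsetP Sr Sab; rewrite -(card_in_imset (f := fst) (D := S)).
  apply: leq_trans (leq_card_ord_interval a b); apply/subset_leq_card/subsetP.
  by move=> _ /imsetP[p pS ->]; rewrite inE Sab.
move=> [i k] [i' k'] /Sr /[!inE]/eqP /= ki /Sr /[!inE]/eqP /= ki' ii'.
by congr (_, _) => //; apply: val_inj; rewrite /= ki ki' ii'.
Qed.

Lemma leq_card_diagonal S r : S \subset diagonal n r -> #|S| <= n - r.
Proof.
move=> Sr; rewrite -[n - r]subn0; apply: (leq_card_diagonal_rows Sr) => -[i c].
by move/(subsetP Sr); rewrite inE /= => /eqP ci; have := ltn_ord c; lia.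
Qed.

Lemma card_sum_columns S : #|S| = \sum_(c < n) #|[set i | (i, c) \in S]|.
Proof.
rewrite card_sum_mem (eq_bigr (fun p => ((p.1, p.2) \in S : nat))); last by case.
rewrite -(pair_bigA _ (fun i c => ((i, c) \in S : nat))) exchange_big /=.
by apply: eq_bigr => c _; rewrite card_sum_mem; apply: eq_bigr => i _; rewrite inE.
Qed.

Lemma sum_card_diagonal S :
  \sum_(r < n) #|S :&: diagonal n r| = #|S :&: upper_triangle n 0|.
Proof.
under eq_bigr => r _ do rewrite card_sum_mem.
rewrite card_sum_mem exchange_big; apply: eq_bigr => -[i c] _ /=; rewrite !inE /= addn0.
have [pS | /negPf pS] := boolP ((i, c) \in S); last first.
  by rewrite big1 // => r _; rewrite !inE pS.
have [le_ic | lt_ci] := leqP i c; last first.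
  by rewrite big1 // => r _; rewrite !inE /=; case: eqP => //; rewrite pS; lia.
have lt_r : c - i < n by have := ltn_ord c; lia.
rewrite (bigD1 (Ordinal lt_r)) //= !inE pS /= subnKC // eqxx big1 // => r nr.
by rewrite !inE pS /=; case: eqP => // cir; case/eqP: nr; apply: val_inj => /=; lia.
Qed.

(* The cells counted by nu D d j, for h = d - 1 - j. *)
Definition remaining D h j : {set 'I_n * 'I_n} :=
  [set p in D | h <= p.1 & p.2 < n - j].

(** A column of height c that reaches row [h] contains all [h] rows above it, so c - h of its cells
    remain, which is its term in [nu]. *)
Lemma leq_card_remaining D d j : ferrers_diagram D -> d <= n -> j < d ->
  #|remaining D (d.-1 - j) j| <= nu D d j.
Proof.
move=> [_ FD] le_dn lt_jd; set h := d.-1 - j.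
rewrite card_sum_columns /nu [leqRHS]big_mkcond; apply: leq_sum => c _.
case: ifP => lt_c; last first.
  by rewrite leqn0 cards_eq0; apply/eqP/setP => i; rewrite !inE lt_c !andbF.
have [-> | [i /[!inE]/and3P[iD /= le_hi _]]] := set_0Vmem [set i | (i, c) \in remaining D h j].
  by rewrite cards0.
have := cardsID [set i : 'I_n | 0 <= i < h] [set i | (i, c) \in D].
have -> : [set i | (i, c) \in D] :&: [set i : 'I_n | 0 <= i < h] = [set i : 'I_n | 0 <= i < h].
  apply/setIidPr/subsetP => i' /[!inE] /= lt_i'; apply: FD iD _.
  by apply: leq_trans le_hi; apply: ltnW.
have -> : [set i | (i, c) \in D] :\: [set i : 'I_n | 0 <= i < h]
          = [set i | (i, c) \in remaining D h j].
  by apply/setP => i'; rewrite !inE /= lt_c -leqNgt andbT andbC.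
rewrite card_ord_interval; last by rewrite /h; lia.
have arith x : h - 0 + x + j + 1 - d = x by rewrite /h; lia.
by rewrite /col_height => <-; rewrite arith.
Qed.

Lemma nu_min_attained D d : 0 < d -> exists2 j, j < d & nu D d j = nu_min D d.
Proof.
move=> d_gt0; rewrite /nu_min; elim/big_ind: _ => [|x y Hx Hy|j _].
(* The default value of the minimum is [nu D d 0], attained because 0 < d. *)
- by exists 0.
- by rewrite /minn; case: ifP.
- by exists j.
Qed.

(** For s <= n - d both sides are 1 + ... + (n - d - s + 1): row t of [theta_supp] has t + 1 - s
    cells, and reversing the order of summation matches rows with diagonals. *)
Lemma leq_card_theta_supp s d : 0 < d <= n ->
  \sum_(r < n | s <= r) (n - r + 1 - d) <= #|theta_supp n s d|.
Proof.
move=> /andP[d_gt0 le_dn].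
have -> : #|theta_supp n s d| = \sum_(t < n) (if t + d <= n then t.+1 - s else 0).
  rewrite card_sum_mem (eq_bigr (fun p => ((p.1, p.2) \in theta_supp n s d : nat)));
    last by case.
  rewrite -(pair_bigA _ (fun t u => ((t, u) \in theta_supp n s d : nat))) /=.
  apply: eq_bigr => t _; case: ifP => le_td; last first.
    by rewrite big1 // => u _; rewrite inE le_td andbF.
  rewrite -[RHS]subn0 -card_ord_interval; last by have := ltn_ord t; lia.
  rewrite card_sum_mem; apply: eq_bigr => u _; rewrite !inE /= le_td andbT.
  by congr nat_of_bool; apply/idP/idP; lia.
rewrite -(big_mkord (fun r => s <= r) (fun r => n - r + 1 - d)).
rewrite -(big_mkord predT (fun t => if t + d <= n then t.+1 - s else 0)).
have le_an : n.+1 - d <= n by lia.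
rewrite (big_cat_nat (leq0n _) le_an) /= [X in _ + X <= _]big_nat_cond.
rewrite [X in _ + X <= _]big1 ?addn0 => [|r]; last by lia.
rewrite [leqRHS](big_cat_nat (leq0n _) le_an) /= -[leqLHS]addn0; apply: leq_add => //.
have [le_sa | lt_as] := leqP s (n.+1 - d); last first.
  by rewrite big_nat_cond big1 // => r; lia.
rewrite [leqRHS](big_cat_nat (leq0n _) le_sa) /= -[leqLHS]add0n; apply: leq_add => //.
rewrite (big_cat_nat (leq0n _) le_sa) /= big_nat_cond big1 ?add0n => [|r]; last by lia.
rewrite big_nat_rev big_mkcond /= big_seq [X in _ <= X]big_seq.
by apply: leq_sum => r; rewrite mem_index_iota; do 2!case: ifP; lia.
Qed.

(** * Diagonals of an MDS-constructible pair *)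

Section MDSConstructible.
Variables (D : {set 'I_n * 'I_n}) (d j : nat).
Hypotheses (le_2dn : 2 <= d <= n) (FD : ferrers_diagram D) (lt_jd : j < d).
Local Notation h := (d.-1 - j).
Local Notation diag := (diagonal n).

(** The inequality is strict because [remaining] also includes row [h]: by the Ferrers property, a
    cell below row [h] forces one in row [h] of the same column. *)
Lemma card_outside_rows_cols :
  0 < nu D d j ->
  #|D :\: [set p : 'I_n * 'I_n | (p.1 <= h) || (n - j <= p.2)]| < nu D d j.
Proof.
set Z := [set p | _] => nu_gt0.
have [-> | [p pDZ]] := set_0Vmem (D :\: Z); first by rewrite cards0.
apply: leq_trans (leq_card_remaining FD _ lt_jd); last by lia.
apply/proper_card/properP; split.
  by apply/subsetP => -[i c] /[!inE] /=; case: (_ \in D); lia.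
have lt_hn : h < n by lia.
move: pDZ; rewrite !inE; case: p => i c /= /andP[pZ pD].
exists (Ordinal lt_hn, c); rewrite !inE /= ?leqnn //.
by rewrite (FD.2 _ _ _ pD) /=; lia.
Qed.

Hypothesis nu_eq : nu D d j = \sum_(r < n) (#|D :&: diagonal n r| + 1 - d).

Let removed r : {set 'I_n * 'I_n} :=
  [set p in diag r | p.1 < h] :|: [set p in diag r | n - j <= p.2].

Let card_removed r : #|removed r| <= d.-1.
Proof.
apply: leq_trans (leq_card_setU _ _) _.
(* The diagonal meets the last [j] columns in the rows from n - j - r to n - r - 1. *)
apply: (@leq_trans (h - 0 + (n - r - (n - j - r)))); last by lia.
apply: leq_add.
  apply: (@leq_card_diagonal_rows r); first by apply/subsetP => p /[!inE]/andP[].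
  by move=> p /[!inE]/andP[_ ->].
apply: (@leq_card_diagonal_rows r); first by apply/subsetP => p /[!inE]/andP[].
by move=> [i c] /[!inE]/= /andP[/eqP ci le_c]; have := ltn_ord c; lia.
Qed.

Let diag_sub_removed r :
  (D :&: diag r) :\: remaining D h j \subset removed r.
Proof.
apply/subsetP => p; rewrite !inE => /andP[+ /andP[pD ->]].
by rewrite pD /= negb_and -ltnNge -leqNgt.
Qed.

Let diag_remaining r :
  #|D :&: diag r| = #|remaining D h j :&: diag r| + #|(D :&: diag r) :\: remaining D h j|.
Proof.
rewrite -(cardsID (remaining D h j)); congr (#|pred_of_set _| + _).
by apply/setP => p; rewrite !inE; case: (p \in D); rewrite /= ?andbT ?andbF // andbC.
Qed.

Let leq_diag_remaining r : #|D :&: diag r| + 1 - d <= #|remaining D h j :&: diag r|.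
Proof.
move: (diag_remaining r) (subset_leq_card (diag_sub_removed r)) (card_removed r).
lia.
Qed.

(** Each diagonal keeps at least its term of the sum, while all of them together keep at most
    [nu D d j], the whole sum; so equality holds on each. A diagonal with at least [d] cells of [D]
    thus loses exactly d - 1 of them, which must be all of [removed r]. *)
Lemma removed_sub_diagram r : d <= #|D :&: diag r| -> removed r \subset D.
Proof.
move=> le_d.
have lt_rn : r < n.
  rewrite ltnNge; apply/negP => le_nr.
  have [[i c] /[!inE]/= /andP[_ /eqP ci]] : exists p, p \in D :&: diag r.
    by apply/card_gt0P; lia.
  by have := ltn_ord c; lia.
have lt_sum : #|remaining D h j :&: diag r| <= #|D :&: diag r| + 1 - d.
  have : \sum_(r < n) #|remaining D h j :&: diag r| <= \sum_(r < n) (#|D :&: diag r| + 1 - d).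
    rewrite sum_card_diagonal -nu_eq; apply: leq_trans (leq_card_remaining FD _ lt_jd).
      exact/subset_leq_card/subsetIl.
    by lia.
  rewrite (bigD1 (Ordinal lt_rn)) //= [leqRHS](bigD1 (Ordinal lt_rn)) //=.
  set x := \sum_(i < n | _) _; set y := \sum_(i < n | _) _.
  have : y <= x by apply: leq_sum => i _; apply: leq_diag_remaining.
  lia.
have /eqP <- : (D :&: diag r) :\: remaining D h j == removed r.
  rewrite eqEcard diag_sub_removed; apply: leq_trans (card_removed r) _.
  move: (diag_remaining r); lia.
by apply/subsetP => p /[!inE]/andP[_ /andP[]].
Qed.

(* On the diagonals r >= r0, D misses only cells with h <= row and column < n - j. *)
Lemma card_diagonalD r0 r : d <= #|D :&: diag r0| -> r0 <= r ->
  #|diag r :\: D| <= n - r + 1 - d.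
Proof.
move=> /removed_sub_diagram/subsetP remD le_r0r.
apply: leq_trans (_ : (n - j - r) - h <= _); last by lia.
apply: (@leq_card_diagonal_rows r); first exact: subsetDl.
move=> -[i c] /[!inE]/andP[/= iDc /eqP ci]; have lt_cn := ltn_ord c.
apply/andP; split.
  rewrite leqNgt; apply: contra iDc => lt_ih.
  (* The cell of row [i] on diagonal [r0] is in [D] and lies weakly left of (i, c). *)
  have lt_c' : i + r0 < n by lia.
  have /remD iD : (i, Ordinal lt_c') \in removed r0 by rewrite !inE /= eqxx lt_ih.
  by apply: FD.1 iD _ => /=; lia.
rewrite ltnNge; apply: contra iDc => le_i.
(* Likewise, the cell of column [c] on diagonal [r0] lies weakly below (i, c). *)
have lt_i' : c - r0 < n by lia.
have /remD cD : (Ordinal lt_i', c) \in removed r0.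
  by rewrite !inE /= subnK ?eqxx /=; lia.
by apply: FD.2 cD _ => /=; lia.
Qed.

Lemma leq_nu_theta_supp r0 : d <= #|D :&: diag r0| ->
  (forall r, d <= #|D :&: diag r| -> r0 <= r) ->
  nu D d j + #|upper_triangle n r0 :\: D| <= #|theta_supp n r0 d|.
Proof.
move=> le_d r0_min; apply: leq_trans (leq_card_theta_supp r0 _); last by lia.
have -> : #|upper_triangle n r0 :\: D| = \sum_(r < n | r0 <= r) #|diag r :\: D|.
  have -> : upper_triangle n r0 :\: D = (upper_triangle n r0 :\: D) :&: upper_triangle n 0.
    by apply/esym/setIidPl/subsetP => p; rewrite !inE; lia.
  rewrite -sum_card_diagonal [RHS]big_mkcond; apply: eq_bigr => r _.
  case: ifP => le_r0r.
    apply: eq_card => p; rewrite !inE -andbA; congr (_ && _).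
    by case: eqP; rewrite ?andbF //; lia.
  by apply/eqP; rewrite cards_eq0; apply/eqP/setP => p; rewrite !inE; case: (_ \in _); lia.
have -> : nu D d j = \sum_(r < n | r0 <= r) (#|D :&: diag r| + 1 - d).
  rewrite nu_eq [RHS]big_mkcond; apply: eq_bigr => r _; case: ifPn => //.
  by move=> lt_r; apply/eqP; rewrite subn_eq0 addn1 ltnNge (contra (r0_min r)).
rewrite -big_split /=; apply: leq_sum => r le_r0r.
(* If a < d the truncated term is 0 and the bound on the missing cells suffices; otherwise the bound
   c <= m on the whole diagonal does. *)
have arith a b c m : b <= m + 1 - d -> a + b = c -> c <= m -> a + 1 - d + b <= m + 1 - d.
  lia.
rewrite [D :&: _]setIC; apply: arith (card_diagonalD le_d le_r0r) (cardsID _ _) _.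
exact: leq_card_diagonal.
Qed.

End MDSConstructible.
End Counting.

Theorem theorem4p22 (n d : nat) (D : {set 'I_n * 'I_n}) :
  2 <= d <= n ->
  ferrers_diagram D ->
  MDS_constructible D d ->
  forall F : finFieldType, exists C : {vspace 'M[F]_n}, MFD_code D d C.
Proof.
move=> le_2dn FD mdsD F; rewrite /MFD_code.
have d_gt0 : 0 < d by lia.
have [j lt_jd nu_j] := nu_min_attained D d_gt0.
have nu_eq := etrans nu_j mdsD; rewrite -nu_j.
have [nu0 | nu_neq0] := eqVneq (nu D d j) 0.
  exists 0%VS; split; rewrite ?dimv0 //; last by left.
  by move=> A; rewrite memv0 => /eqP -> i k _; rewrite mxE.
have [r0 le_d r0_min] : exists2 r0, d <= #|D :&: diagonal n r0| &
    forall r, d <= #|D :&: diagonal n r| -> r0 <= r.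
  have ex_r : exists r, d <= #|D :&: diagonal n r|.
    move: nu_neq0; rewrite nu_eq sum_nat_eq0 => /forallPn[r].
    by rewrite implyTb subn_eq0 addn1 -leqNgt => ?; exists r.
  by case: (ex_minnP ex_r) => r0 ? ?; exists r0.
have le_dr0 : d + r0 <= n.
  by have := leq_trans le_d (leq_card_diagonal (subsetIr _ _)); lia.
have [W [sWU rkW dimW]] := triangular_code F d_gt0 le_dr0.
have dimV : nu D d j <= \dim (W :&: supp_space F D).
  have := leq_nu_theta_supp le_2dn FD lt_jd nu_eq le_d r0_min.
  rewrite -dimW => le1; have := leq_trans le1 (dim_cap_supp_space D sWU).
  by rewrite leq_add2r.
(* The intersection may be larger than required; a subspace inherits the support and the rank
   bound. *)
have [C sCV dimC] := exists_subspace dimV.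
have rkC A : A \in C -> A != 0%R -> d <= \rank A.
  by move/(subvP sCV) => /memv_capP[AW _]; apply: rkW.
have suppC A : A \in C -> supported_on D A.
  by move/(subvP sCV) => /memv_capP[_ /supp_spaceP].
exists C; split=> //; right; split=> //.
set Z := [set p : 'I_n * 'I_n | (p.1 <= d.-1 - j) || (n - j <= p.2)].
have sCD : (C <= supp_space F D)%VS by apply/subvP => A /suppC/supp_spaceP.
(* Only the fewer than dim C cells of [D :\: Z] have to be annihilated, so a nonzero codeword
   survives on the d - j rows and [j] columns of [Z]. *)
have : 0 < \dim (C :&: supp_space F Z).
  rewrite -(ltn_add2r #|D :\: Z|) add0n; apply: leq_trans (dim_cap_supp_space Z sCD).
  by rewrite dimC card_outside_rows_cols // lt0n.
rewrite lt0n dimv_eq0 -vpick0.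
have := memv_pick (C :&: supp_space F Z); set A := vpick _.
case/memv_capP=> AC /supp_spaceP AZ A_neq0; exists A; split=> //.
apply/eqP; rewrite eqn_leq rkC // andbT.
apply: leq_trans (_ : (d.-1 - j).+1 + j <= d); last by lia.
apply: rank_rows_cols; [lia | lia | move=> i k lt_i lt_k].
by apply: AZ; rewrite inE /=; lia.
Qed.
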